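(* For any $\delta$-pair $([n],\mathcal{A})$ and $([n],\mathcal{B})$, $$\min\{|\mathcal{A}|,|\mathcal{B}|\}\ \le\ \begin{cases}\displaystyle\sum_{i=0}^{\delta/2}\binom{n}{i}, & \text{if } \delta\equiv 0 \pmod 2,\\[2mm] \displaystyle\sum_{i=0}^{(\delta-1)/2}\binom{n}{i}+\binom{n-1}{(\delta-1)/2}, & \text{if }\delta\equiv 1\pmod 2,\end{cases}$$ with equality if $$\mathcal{A}=\mathcal{B}=\begin{cases}\displaystyle\bigcup_{i=0}^{\delta/2}\binom{[n]}{i}, & \text{if } \delta\equiv 0 \pmod 2,\\[2mm] \displaystyle\bigcup_{i=0}^{(\delta-1)/2}\binom{[n]}{i}\ \cup\ \Big\{A\cup\{x\}: A\in\binom{[n]\setminus\{x\}}{(\delta-1)/2}\Big\}, & \text{if }\delta\equiv 1\pmod 2,\end{cases}$$ where $x$ is any fixed element of $[n]$.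
   Context: $n$ and $\delta$ are integers. $[n]=\{1,\dots,n\}$; $2^{X}$ is the set of all subsets of $X$; for a set $X$, $\binom{X}{k}$ is the set of all $k$-element subsets of $X$, while $\binom{n}{i}$ with $n$ an integer is the binomial coefficient. A set system of order $n$ on $[n]$ is a pair $([n],\mathcal{A})$ with $\mathcal{A}\subseteq 2^{[n]}$. $A\Delta B$ denotes the symmetric difference. Two set systems $([n],\mathcal{A})$ and $([n],\mathcal{B})$ form a $\delta$-pair if $|A\Delta B|\le\delta$ for all $A\in\mathcal{A}$ and $B\in\mathcal{B}$.
   Formalization: The inequality is proved for δ < n or δ ≥ 2n−1 only: for n ≤ δ < 2n−1 it is false, since A = B = 2^[n] is a δ-pair with 2^n members, more than the bound (e.g. n = δ = 2: 4 > 3). The equality part is unrestricted; δ is taken nonnegative. *)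

(* Defs.v *)
From mathcomp Require Import all_boot.
Set Implicit Arguments.
Unset Strict Implicit.
Unset Printing Implicit Defensive.

(* MathComp.  The ground set [n] is 'I_n, and a set system on [n] is a
   {set {set 'I_n}}. *)

Definition symdiff (T : finType) (A B : {set T}) : {set T} :=
  (A :\: B) :|: (B :\: A).

Definition delta_pair (n delta : nat) (FA FB : {set {set 'I_n}}) : Prop :=
  forall A B : {set 'I_n}, A \in FA -> B \in FB -> #|symdiff A B| <= delta.

Definition ksubsets (T : finType) (X : {set T}) (k : nat) : {set {set T}} :=
  [set A : {set T} | A \subset X & #|A| == k].

(* In the odd case (delta - 1) / 2 is written delta.-1./2; both halvings are
   exact for the parity in which they are used. *)
Definition pair_bound (n delta : nat) : nat :=
  if odd delta
  then \sum_(0 <= i < (delta.-1)./2.+1) 'C(n, i) + 'C(n.-1, (delta.-1)./2)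
  else \sum_(0 <= i < delta./2.+1) 'C(n, i).

Definition even_extremal (n delta : nat) : {set {set 'I_n}} :=
  \bigcup_(0 <= i < delta./2.+1) ksubsets [set: 'I_n] i.

Definition odd_extremal (n delta : nat) (x : 'I_n) : {set {set 'I_n}} :=
  \bigcup_(0 <= i < (delta.-1)./2.+1) ksubsets [set: 'I_n] i
  :|: [set A :|: [set x] | A in ksubsets ([set: 'I_n] :\ x) (delta.-1)./2].

Definition is_extremal (n delta : nat) (F : {set {set 'I_n}}) : Prop :=
  if odd delta then exists x : 'I_n, F = odd_extremal delta x
  else F = even_extremal n delta.

(* Main.v *)
(** Fix [x] in the ground set and give [x] weight 1, every other element
    weight 2.  For both parities of [delta] the extremal family is the set of
    all [A] of weight at most [delta].  Replacing [U] by [V] in the members of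
    both families simultaneously, for disjoint [U], [V] with [V] lighter than
    [U], preserves the bound on the distances provided that all smaller pairs
    [(U, V)] already leave the families unchanged (compression in the style of
    Frankl and Furedi's proof of Harper's theorem).  Hence one may assume that
    both families are closed under passing to a set of smaller weight.  If
    [delta < n] and both were larger than the extremal family, each would contain it and also a set
    of weight greater than [delta], which lies too far from some set of weight
    at most [delta]. *)
Require Import Defs.
From mathcomp Require Import all_boot.
From mathcomp Require Import zify.

Set Implicit Arguments.
Unset Strict Implicit.
Unset Printing Implicit Defensive.

(** * Weights, and replacing one set by another inside a set *)

Section Weight.
Variables (T : finType) (x : T).
Implicit Types A B U V : {set T}.

Definition weight A := \sum_(i in A) (if i == x then 1 else 2).

Lemma card_sum_mem A : #|A| = \sum_i (i \in A).
Proof. by rewrite -sum1_card big_mkcond /=; apply: eq_bigr => i _; case: ifP. Qed.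

Lemma weightE A : weight A + (x \in A) = 2 * #|A|.
Proof.
have -> : (x \in A : nat) = \sum_(i in A) (i == x).
  case xA: (x \in A).
    rewrite (bigD1 x) //= eqxx big1 // => i /andP[_ /negPf->] //.
  by rewrite big1 // => i iA; case: eqP iA => // ->; rewrite xA.
by rewrite -big_split -sum1_card big_distrr /=; apply: eq_bigr => i _; case: eqP.
Qed.

Lemma weight_bounds A : 2 * #|A| <= (weight A).+1 /\ weight A <= 2 * #|A|.
Proof. by have := weightE A; case: (x \in A); lia. Qed.

Lemma weight_sub A B : A \subset B -> weight A <= weight B.
Proof.
move/subsetP=> AB; rewrite /weight big_mkcond [leqRHS]big_mkcond /=.
by apply: leq_sum => i _; have := AB i; case: (i \in A) => // ->.
Qed.

Definition replaceable U V A := (U \subset A) && (V \subset ~: A).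
Definition replace U V A := (A :\: U) :|: V.

Lemma replaceableP U V A i : replaceable U V A ->
  ((i \in U) ==> (i \in A)) && ((i \in V) ==> (i \notin A)).
Proof.
case/andP=> /subsetP UA /subsetP VA; apply/andP; split; apply/implyP; first exact: UA.
by move/VA; rewrite inE.
Qed.

Lemma weight_replace U V A : replaceable U V A ->
  weight (replace U V A) + weight U = weight A + weight V.
Proof.
move=> rA; rewrite /weight !(big_mkcond (fun i => i \in _)) -!big_split /=.
apply: eq_bigr => i _; have := replaceableP i rA; rewrite !inE.
by case: (i \in A); case: (i \in U); case: (i \in V) => //= _; rewrite ?addn0 ?add0n.
Qed.

Lemma replace_inj U V A B : replaceable U V A -> replaceable U V B ->
  replace U V A = replace U V B -> A = B.
Proof.
move=> rA rB /setP eAB; apply/setP=> i; have := eAB i.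
have := replaceableP i rA; have := replaceableP i rB; rewrite !inE.
by case: (i \in A); case: (i \in U); case: (i \in V); case: (i \in B) => //=.
Qed.

Lemma symdiffC A B : symdiff A B = symdiff B A.
Proof. by rewrite /symdiff setUC. Qed.

Lemma symdiff_replace U V A B : replaceable U V A -> replaceable U V B ->
  symdiff (replace U V A) (replace U V B) = symdiff A B.
Proof.
move=> rA rB; apply/setP=> i.
have := replaceableP i rA; have := replaceableP i rB; rewrite !inE.
by case: (i \in A); case: (i \in U); case: (i \in V); case: (i \in B) => //=.
Qed.

Lemma symdiff_replace_swap U V A B : replaceable U V A -> replaceable U V B ->
  symdiff (replace U V A) B = symdiff A (replace U V B).
Proof.
move=> rA rB; apply/setP=> i.
have := replaceableP i rA; have := replaceableP i rB; rewrite !inE.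
by case: (i \in A); case: (i \in U); case: (i \in V); case: (i \in B) => //=.
Qed.

(** Counted element by element. Moving [A] alone changes the distance by
    [|V| - |U| + 2|U :&: B| - 2|V :&: B|], whereas [W] lies in [A] and [V'] misses [A], so trading
    [W] for [V'] in [B] adds [|W| + |V'|]. Everything is on the additive side to avoid truncated
    subtraction. *)
Lemma card_symdiff_replace U V (W V' : {set T}) A B :
  [disjoint U & V] -> replaceable U V A -> W \subset U :&: B ->
  V' \subset V :\: B ->
  #|symdiff (replace U V A) B| + #|U| + 2 * #|V :&: B| + #|V'| + #|W| =
  #|symdiff A (replace W V' B)| + #|V| + 2 * #|U :&: B|.
Proof.
move=> dUV rA /subsetP sW /subsetP sV'.
rewrite !card_sum_mem !big_distrr -!big_split /=.
apply: eq_bigr => i _; have := replaceableP i rA.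
have /implyP := sW i; have /implyP := sV' i.
have : ~~ ((i \in U) && (i \in V)).
  by apply/negP=> /andP[iU]; rewrite (disjointFr dUV iU).
rewrite !inE.
by case: (i \in A); case: (i \in U); case: (i \in V); case: (i \in B);
   case: (i \in V'); case: (i \in W).
Qed.

Definition stable (F : {set {set T}}) U V :=
  [forall A in F, replaceable U V A ==> (replace U V A \in F)].

Lemma stableP F U V A : stable F U V -> A \in F -> replaceable U V A ->
  replace U V A \in F.
Proof. by move/forall_inP=> sF AF rA; have := sF A AF; rewrite rA. Qed.

Definition admissible U V := [disjoint U & V] && (weight V < weight U).

Lemma subset_of_card (A : {set T}) m : m <= #|A| ->
  exists2 B : {set T}, B \subset A & #|B| = m.
Proof.
move=> mA; have : 0 < #|[set B : {set T} | B \subset A & #|B| == m]|.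
  by rewrite cards_draws bin_gt0.
by case/card_gt0P=> B; rewrite inE => /andP[BA /eqP]; exists B.
Qed.

Lemma subset_of_card_mem (A : {set T}) m : x \in A -> 0 < m <= #|A| ->
  exists B : {set T}, [/\ B \subset A, x \in B & #|B| = m].
Proof.
move=> xA; have := cardsD1 x A; rewrite xA => cA /andP[m0 mA].
have [|B /subsetP BA cB] := @subset_of_card (A :\ x) m.-1; first by lia.
exists (x |: B); rewrite setU11; split=> //.
  by apply/subsetP=> i; rewrite !inE => /orP[/eqP-> //|/BA]; rewrite inE => /andP[].
by rewrite cardsU1 cB; case: (boolP (x \in B)) => [/BA|]; rewrite ?inE ?eqxx //=; lia.
Qed.

(* The distance lost by moving [A] but not [B] is recovered by applying to [B]
   a smaller admissible replacement of [U :&: B] by a subset of [V :\: B]. *)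
Lemma stable_witness (G : {set {set T}}) U V A B :
  admissible U V -> replaceable U V A -> B \in G -> ~~ replaceable U V B ->
  (forall U' V', #|U'| + #|V'| < #|U| + #|V| -> admissible U' V' ->
     stable G U' V') ->
  exists2 B', B' \in G & #|symdiff (replace U V A) B| <= #|symdiff A B'|.
Proof.
move=> /andP[dUV wUV] rA BG rB sG.
have := weight_bounds U; have := weight_bounds V; have := weight_bounds (U :&: B).
have := weight_bounds (V :\: B); have := cardsID B U; have := cardsID B V.
(* This makes the pair [(U :&: B, V :\: B)] strictly smaller than [(U, V)]. *)
have : 0 < #|V :&: B| + #|U :\: B|.
  rewrite lt0n; apply: contra rB; rewrite addn_eq0 !cards_eq0 setD_eq0 setI_eq0.
  by case/andP=> dVB UB; rewrite /replaceable UB -disjoints_subset.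
move=> proper cV cU wVB wUB wV wU.
have id0 : #|symdiff (replace U V A) B| + #|U| + 2 * #|V :&: B| =
    #|symdiff A B| + #|V| + 2 * #|U :&: B|.
  have := card_symdiff_replace dUV rA (sub0set (U :&: B)) (sub0set (V :\: B)).
  by rewrite /replace setD0 setU0 !cards0 !addn0.
(* If moving [A] does not increase the distance, [B] itself is the witness. *)
have [small|large] := leqP (#|V| + 2 * #|U :&: B|) (#|U| + 2 * #|V :&: B|).
  by exists B => //; lia.
suff [V' [sV' wV' cV']] : exists V' : {set T}, [/\ V' \subset V :\: B,
    weight V' < weight (U :&: B) & #|V| + #|U :&: B| <= #|U| + 2 * #|V :&: B| + #|V'|].
  have [V'V V'B] : V' \subset V /\ V' \subset ~: B.
    by move: sV'; rewrite setDE subsetI => /andP.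
  exists (replace (U :&: B) V' B); last first.
    by have := card_symdiff_replace dUV rA (subxx (U :&: B)) sV'; lia.
  apply: stableP => //; last by rewrite /replaceable subsetIr.
  apply: sG; first by have := subset_leq_card sV'; lia.
  rewrite /admissible wV' andbT.
  exact: disjointWl (subsetIl _ _) (disjointWr V'V dUV).
have [wlt|wge] := ltnP (weight (V :\: B)) (weight (U :&: B)).
  by exists (V :\: B); split=> //; lia.
(* One element fewer than [U :&: B] is lighter whatever the position of [x], and [full] says that it
   gains enough distance. *)
have [full|lt] := leqP (#|V| + 1) (#|U| + 2 * #|V :&: B|).
  have [|V' sV' cV'] := @subset_of_card (V :\: B) (#|U :&: B|.-1); first by lia.
  by exists V'; split=> //; have := weight_bounds V'; lia.
(* Here [B] is disjoint from [V] and [#|U| = #|V|], so [V] is lighter only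
   because it contains [x]. *)
have [xV xU] : x \in V /\ x \notin U.
  have xV : x \in V.
    by have := weightE V; have := weightE U; case: (x \in V) => //; case: (x \in U); lia.
  by rewrite xV (disjointFl dUV xV).
have VB : V :\: B = V by apply/eqP; rewrite eqEcard subsetDl; lia.
(* Now the full size is needed; containing [x] makes [V'] lighter by one than [U :&: B], which
   misses [x]. *)
have [|V' [sV' xV' cV']] := @subset_of_card_mem V #|U :&: B| xV; first by lia.
exists V'; rewrite VB; split=> //; last by lia.
have := weightE V'; have := weightE (U :&: B).
by rewrite inE (negPf xU) xV' /=; clear -cV' proper VB cV; lia.
Qed.

(** * Compression to a stable pair of families *)

Definition compress U V (F : {set {set T}}) A :=
  if replaceable U V A && (replace U V A \notin F) then replace U V A else A.

(** Moved sets land outside [F] and the others stay in [F], so only two moved sets could collide,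
    and on these replacement is invertible. *)
Lemma compress_inj (F : {set {set T}}) U V : {in F &, injective (compress U V F)}.
Proof.
move=> A B AF BF; rewrite /compress.
case: ifP => [/andP[rA sA]|_]; case: ifP => [/andP[rB sB]|_] //.
- exact: replace_inj.
- by move=> eAB; rewrite eAB BF in sA.
- by move=> eAB; rewrite -eAB AF in sB.
Qed.

Definition cross_bounded d (F G : {set {set T}}) :=
  forall A B, A \in F -> B \in G -> #|symdiff A B| <= d.

(** If only [A] moves, then either [B] is blocked by its own replacement already in [G], and the
    distance equals that from [A] to this replacement, or [B] is not replaceable and
    [stable_witness] applies. *)
Lemma compress_cross_bounded d (F G : {set {set T}}) U V :
  cross_bounded d F G -> admissible U V ->
  (forall U' V', #|U'| + #|V'| < #|U| + #|V| -> admissible U' V' ->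
     stable F U' V' && stable G U' V') ->
  cross_bounded d (compress U V F @: F) (compress U V G @: G).
Proof.
move=> dFG aUV sFG _ _ /imsetP[A AF ->] /imsetP[B BG ->]; rewrite /compress.
case: ifP => [/andP[rA sA]|sA]; case: ifP => [/andP[rB sB]|sB].
- by rewrite symdiff_replace //; apply: dFG.
- have [rB|rB] := boolP (replaceable U V B).
    by rewrite symdiff_replace_swap //; apply: dFG => //; rewrite rB in sB; move/negPn: sB.
  have [|B' B'G] := stable_witness aUV rA BG rB.
    by move=> U' V' lt /(sFG _ _ lt)/andP[].
  by move/leq_trans; apply; apply: dFG.
- rewrite symdiffC; have [rA|rA] := boolP (replaceable U V A).
    rewrite symdiff_replace_swap // symdiffC; apply: dFG => //.
    by rewrite rA in sA; move/negPn: sA.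
  have [|A' A'F] := stable_witness aUV rB AF rA.
    by move=> U' V' lt /(sFG _ _ lt)/andP[].
  by move/leq_trans; apply; rewrite symdiffC; apply: dFG.
- exact: dFG.
Qed.

Lemma weight_compress U V (F : {set {set T}}) A : admissible U V ->
  weight (compress U V F A) <= weight A.
Proof.
move=> /andP[_ wUV]; rewrite /compress; case: ifP => // /andP[rA _].
by have := weight_replace rA; lia.
Qed.

Definition total_weight (F : {set {set T}}) := \sum_(A in F) weight A.

Lemma total_weight_compress U V (F : {set {set T}}) : admissible U V ->
  total_weight (compress U V F @: F) + ~~ stable F U V <= total_weight F.
Proof.
move=> aUV; rewrite /total_weight big_imset; last exact: compress_inj.
have [_|/forall_inPn[A AF]] := boolP (stable F U V).
  by rewrite addn0; apply: leq_sum => A _; apply: weight_compress.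
rewrite negb_imply => /andP[rA sA].
rewrite (bigD1 A) //= [leqRHS](bigD1 A) //= addnAC leq_add //; last first.
  by apply: leq_sum => B _; apply: weight_compress.
have /andP[_ wUV] := aUV.
by rewrite /compress rA sA /= addn1; have := weight_replace rA; lia.
Qed.

(** Induction on the total weight, which drops when some set moves. Choosing an unstable pair of
    least total size makes all smaller admissible pairs stable, as [compress_cross_bounded]
    requires. *)
Lemma exists_stable_pair d (F G : {set {set T}}) : cross_bounded d F G ->
  exists F' G' : {set {set T}}, [/\ #|F'| = #|F|, #|G'| = #|G|, cross_bounded d F' G' &
    forall U V, admissible U V -> stable F' U V && stable G' U V].
Proof.
have [m] := ubnP (total_weight F + total_weight G).
elim: m F G => // m IHm F G lem dFG.
pose unstable (p : {set T} * {set T}) :=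
  admissible p.1 p.2 && ~~ (stable F p.1 p.2 && stable G p.1 p.2).
have [p0 up0|none] := pickP unstable; last first.
  exists F, G; split=> // U V aUV.
  by have := none (U, V); rewrite /unstable aUV => /negbFE.
case: (arg_minnP (fun p : {set T} * {set T} => #|p.1| + #|p.2|) up0) => -[U V] /andP[/= aUV uUV] minUV.
have [||F' [G' [cF' cG' dF'G' sF'G']]] :=
    IHm (compress U V F @: F) (compress U V G @: G).
- have := total_weight_compress F aUV; have := total_weight_compress G aUV.
  by move: uUV; rewrite negb_and; case: (stable F U V); case: (stable G U V) => //= _; lia.
- apply: compress_cross_bounded => // U' V' lt aUV'.
  apply: contraLR lt => uUV'; rewrite -leqNgt.
  by apply: (minUV (U', V')); rewrite /unstable aUV'.
exists F', G'; split=> //; first by rewrite cF' card_in_imset //; apply: compress_inj.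
by rewrite cG' card_in_imset //; apply: compress_inj.
Qed.

(** Passing from [A] to [B] is itself the replacement of [A :\: B] by [B :\: A]. *)
Lemma stable_lower (F : {set {set T}}) A B :
  (forall U V, admissible U V -> stable F U V) ->
  A \in F -> weight B < weight A -> B \in F.
Proof.
move=> sF AF wBA.
have rA : replaceable (A :\: B) (B :\: A) A by rewrite /replaceable subsetDl setDE subsetIr.
have eB : replace (A :\: B) (B :\: A) A = B.
  by apply/setP=> i; rewrite !inE; case: (i \in A); case: (i \in B).
rewrite -eB; apply: (stableP _ AF rA); apply: sF; apply/andP; split.
  rewrite -setI_eq0; apply/eqP/setP=> i.
  by rewrite !inE; case: (i \in A); case: (i \in B).
by have := weight_replace rA; rewrite eB; lia.
Qed.

(** * Weight balls and their optimality *)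

Definition weight_ball d := [set A : {set T} | weight A <= d].

(** The possible weights [2|A|] and [2|A| - 1] lie on the same side of an even bound; an odd bound
    separates them for one size only. *)
Lemma weight_le_even A d : ~~ odd d -> (weight A <= d) = (#|A| < d./2.+1).
Proof.
move=> /negPf od; have := weightE A; have := odd_double_half d; rewrite od.
by case: (x \in A) => /= *; apply/idP/idP; lia.
Qed.

Lemma weight_le_odd A d : odd d ->
  (weight A <= d) = (#|A| < d.-1./2.+1) || (x \in A) && (#|A| == d.-1./2.+1).
Proof.
move=> od; have := weightE A; have := odd_double_half d; rewrite od.
by case: (x \in A) => /= *; apply/idP/idP; lia.
Qed.

(** Adding the weights gives [|A| + |B| <= d], or [d + 1] if both sets contain [x]; in that case the
    common element [x] lowers the distance by two. *)
Lemma weight_ball_cross_bounded d : cross_bounded d (weight_ball d) (weight_ball d).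
Proof.
move=> A B; rewrite !inE => wA wB.
have := weightE A; have := weightE B.
have : (x \in A) + (x \in B) <= (x \in A :&: B).+1.
  by rewrite inE; case: (x \in A); case: (x \in B).
have : (x \in A :&: B) <= #|A :&: B|.
  by case: (boolP (x \in _)) => // xAB; rewrite card_gt0; apply/set0Pn; exists x.
have := cardsID B A; have := cardsID A B; rewrite (setIC B A).
by rewrite /symdiff; have := (leq_card_setU (A :\: B) (B :\: A)).1; lia.
Qed.

(** [A'] and [B] are chosen disjoint with [d + 1] elements in total, which fit since [d < #|T|]. For
    odd [d] the light element [x] is reserved for [B], bringing its weight down to [d]. *)
Lemma far_from_ball d A : d < #|T| -> d < weight A ->
  exists A' B, [/\ A' \subset A, weight B <= d & d < #|symdiff A' B|].
Proof.
move=> dT wA; have cardU (C D : {set T}) : [disjoint C & D] -> #|symdiff C D| = #|C| + #|D|.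
  move=> dCD; rewrite /symdiff (setDidPl dCD) (setDidPl _) 1?disjoint_sym //.
  by rewrite cardsU disjoint_setI0 // cards0 subn0.
have wE := weightE A; have dE := odd_double_half d.
have cC (C : {set T}) := cardsC C.
case: (boolP (odd d)) dE => /= od dE.
  have := cardsD1 x A => cA.
  have [|A' A'A cA'] := @subset_of_card (A :\ x) d./2.+1; first by case: (x \in A) wE cA; lia.
  have /subsetD1P[A'A1 xA'] := A'A.
  have [||B [BA' xB cB]] := @subset_of_card_mem (~: A') d./2.+1; rewrite ?inE //.
    by have := cC A'; lia.
  exists A', B; split=> //; first by have := weightE B; rewrite xB /=; lia.
  by rewrite cardU; [lia | rewrite disjoint_sym -[A']setCK -subsets_disjoint].
have [|A' A'A cA'] := @subset_of_card A d./2.+1; first by lia.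
have [|B BA' cB] := @subset_of_card (~: A') d./2; first by have := cC A'; lia.
exists A', B; split=> //; first by have := weightE B; lia.
by rewrite cardU; [lia | rewrite disjoint_sym -[A']setCK -subsets_disjoint].
Qed.

Lemma cross_bounded_min d (F G : {set {set T}}) : d < #|T| -> cross_bounded d F G ->
  minn #|F| #|G| <= #|weight_ball d|.
Proof.
move=> dT /exists_stable_pair[F' [G' [<- <- dFG sFG]]].
rewrite leqNgt leq_min; apply/negP=> /andP[cF cG].
have escape (H : {set {set T}}) : #|weight_ball d| < #|H| -> exists2 A, A \in H & d < weight A.
  move=> cH; have /subsetPn[A AH] : ~~ (H \subset weight_ball d).
    by apply: contraL cH => /subset_leq_card; rewrite leqNgt.
  by rewrite inE -ltnNge; exists A.
have [A AF wA] := escape _ cF; have [C CG wC] := escape _ cG.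
have [A' [B [A'A wB]]] := far_from_ball dT wA.
(* [B] is lighter than [C], and [A'] is either [A] or a proper subset, hence lighter; stability puts
   both in the families. *)
rewrite ltnNge => /negP[]; apply: dFG; last first.
  by apply: (@stable_lower _ C) => // [U V /sFG/andP[]|]; lia.
have [->//|neq] := eqVneq A' A.
apply: (@stable_lower _ A) => // [U V /sFG/andP[]//|].
have /proper_card ltA : A' \proper A by rewrite properEneq neq.
have /implyP := subsetP A'A x; have := weightE A; have := weightE A'.
by case: (x \in A'); case: (x \in A) => //=; lia.
Qed.

End Weight.

(** * The extremal families as weight balls, and their sizes *)

Lemma card_ksubsets_ball (T : finType) m :
  #|[set A : {set T} | #|A| < m]| = \sum_(0 <= i < m) 'C(#|T|, i).
Proof.
elim: m => [|m IHm]; first by rewrite big_geq // eq_card0 // => A; rewrite inE.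
rewrite big_nat_recr //= -IHm -card_draws -cardsUI.
set I := _ :&: _; have -> : I = set0.
  by apply/setP=> A; rewrite !inE; case: eqP => [->|]; rewrite ?ltnn ?andbF.
by rewrite cards0 addn0; apply: eq_card => A; rewrite !inE ltnS leq_eqVlt orbC.
Qed.

Lemma bigcup_ksubsets (T : finType) m :
  \bigcup_(0 <= i < m) ksubsets [set: T] i = [set A : {set T} | #|A| < m].
Proof.
elim: m => [|m IHm]; first by rewrite big_geq //; apply/setP=> A; rewrite !inE.
rewrite big_nat_recr //= IHm; apply/setP=> A.
by rewrite !inE subsetT ltnS [#|A| <= m]leq_eqVlt orbC.
Qed.

Lemma even_extremalE n delta (x : 'I_n) : ~~ odd delta ->
  even_extremal n delta = weight_ball x delta.
Proof.
move=> od; rewrite /even_extremal bigcup_ksubsets; apply/setP=> A.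
by rewrite !inE weight_le_even.
Qed.

Lemma mem_star (T : finType) (x : T) k (A : {set T}) :
  (A \in [set B :|: [set x] | B in ksubsets ([set: T] :\ x) k]) =
  (x \in A) && (#|A| == k.+1).
Proof.
apply/imsetP/andP=> [[B]|[xA cA]].
  rewrite inE => /andP[/subsetD1P[_ xB] /eqP <-] ->.
  by rewrite setUC setU11 cardsU1 xB.
exists (A :\ x); last by rewrite setUC setD1K.
by rewrite inE setSD ?subsetT //=; move: cA; rewrite (cardsD1 x) xA.
Qed.

Lemma odd_extremalE n delta (x : 'I_n) : odd delta ->
  odd_extremal delta x = weight_ball x delta.
Proof.
move=> od; rewrite /odd_extremal bigcup_ksubsets; apply/setP=> A.
by rewrite inE mem_star !inE weight_le_odd.
Qed.

Lemma card_even_extremal n delta : ~~ odd delta ->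
  #|even_extremal n delta| = pair_bound n delta.
Proof.
move=> /negPf od.
by rewrite /even_extremal /pair_bound od bigcup_ksubsets card_ksubsets_ball card_ord.
Qed.

Lemma card_odd_extremal n delta (x : 'I_n) : odd delta ->
  #|odd_extremal delta x| = pair_bound n delta.
Proof.
move=> od; rewrite /odd_extremal /pair_bound od bigcup_ksubsets cardsU.
set I := _ :&: _; have -> : I = set0.
  apply/setP=> A; rewrite inE mem_star !inE.
  by case: eqP => [->|]; rewrite ?ltnn ?andbF.
rewrite cards0 subn0 card_ksubsets_ball card_ord card_in_imset.
  rewrite cards_draws; have := cardsD1 x [set: 'I_n].
  by rewrite inE cardsT card_ord => /(congr1 predn) ->.
move=> A B; rewrite !inE => /andP[/subsetD1P[_ xA] _] /andP[/subsetD1P[_ xB] _] eAB.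
by rewrite -(setU1K xA) -(setU1K xB) ![x |: _]setUC eAB.
Qed.

Lemma card_weight_ball n delta (x : 'I_n) :
  #|weight_ball x delta| = pair_bound n delta.
Proof.
case: (boolP (odd delta)) => od.
  by rewrite -odd_extremalE // card_odd_extremal.
by rewrite -even_extremalE // card_even_extremal.
Qed.

Lemma pair_bound_gt0 n delta : 0 < pair_bound n delta.
Proof.
rewrite /pair_bound; case: ifP => _; rewrite big_nat_recl // bin0 //.
Qed.

(* The bound fails when n <= delta < 2n - 1: the power set of [n] then forms a
   delta-pair with itself but has more than pair_bound n delta elements. *)
Theorem theorem4 (n delta : nat) (FA FB : {set {set 'I_n}}) :
  (delta < n \/ 2 * n <= delta + 1 ->
   delta_pair delta FA FB -> minn #|FA| #|FB| <= pair_bound n delta) /\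
  (is_extremal delta FA -> FA = FB ->
   delta_pair delta FA FB /\ minn #|FA| #|FB| = pair_bound n delta).
Proof.
split=> [dn dFAB|extA <-]; last first.
  rewrite minnn; move: extA; rewrite /is_extremal.
  case: ifP => [od [x ->]|/negbT od ->].
    split; last exact: card_odd_extremal.
    by rewrite odd_extremalE //; apply: weight_ball_cross_bounded.
  split; last exact: card_even_extremal.
  (* A weight needs a point [x]; over the empty ground set all distances are zero. *)
  case: n FA {FB} => [|n] _; last first.
    by rewrite (even_extremalE ord0) //; apply: weight_ball_cross_bounded.
  move=> A B _ _; apply: leq_trans (max_card _) _.
  by rewrite card_ord.
case: n FA FB dn dFAB => [|n] FA FB dn dFAB.
  apply: leq_trans (geq_minl _ _) (leq_trans (max_card _) _).
  by rewrite -cardsT -powersetT card_powerset cardsT card_ord pair_bound_gt0.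
rewrite -(card_weight_ball delta ord0).
have [lt|ge] := ltnP delta n.+1.
  by apply: cross_bounded_min => //; rewrite card_ord.
(* Here the whole ground set has weight [2 * n.+1 - 1 <= delta], so the ball contains every set. *)
apply: leq_trans (geq_minl _ _) (subset_leq_card _).
apply/subsetP=> A _; rewrite inE; case: dn => [|big]; first by lia.
apply: leq_trans (weight_sub ord0 (subsetT A)) _.
by have := weightE ord0 [set: 'I_n.+1]; rewrite inE cardsT card_ord /=; lia.
Qed.
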